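(* Let $M$ be a connected complete Riemannian manifold of nonpositive sectional curvature with $\operatorname{vol}(M) < \infty$. Let $K$ be its universal covering space and $p : K \to M$ a covering map. Let $m \in \mathbb{N}$, $m \geq 1$, and let $C \subset K$ be a convex set such that $$\operatorname{vol}(C) > m \operatorname{vol}(M).$$ Then there exist pairwise distinct points $x_1, \dots, x_m \in C$ and a point $q \in M$ with $p(x_1) = \dots = p(x_m) = q$. Moreover, for $i \in \{2,\dots,m\}$, the geodesic arcs $\gamma_{x_i,x_1} \subset C$ map under $p$ to $m-1$ loops $p(\gamma_{x_i,x_1})$ with base point $q$ that are homotopically pairwise distinct, i.e. they represent pairwise distinct elements of $\pi_1(M,q)$.
   Context: The universal covering $K$ carries the Riemannian metric pulled back from $M$, so that $p$ is a Riemannian covering (a local isometry), and $K$ is a simply connected complete Riemannian manifold of nonpositive curvature. $\operatorname{vol}$ denotes Riemannian volume (on $M$ and on $K$ respectively). For $x, y \in K$, $\gamma_{x,y}$ denotes the geodesic arc in $K$ connecting $x$ and $y$, which is unique. A set $C \subset K$ is convex if $\gamma_{x,y} \subset C$ for all $x, y \in C$. *)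

(* Defs.v *)
From HB Require Import structures.
From mathcomp Require Import all_boot all_order all_algebra.
From mathcomp Require Import all_classical all_reals all_analysis.
Import Order.TTheory GRing.Theory Num.Theory.
Import numFieldNormedType.Exports.

Set Implicit Arguments.
Unset Strict Implicit.
Unset Printing Implicit Defensive.

Local Open Scope classical_set_scope.
Local Open Scope ring_scope.

(* Vectors are rows: a linear map acts by v |-> v *m J, which is the convention
   of the library's Jacobian 'J. *)

Section Calculus.
Context {R : realType}.

Definition partial {n} {V : normedModType R} (i : 'I_n) (f : 'rV[R]_n -> V) :
  'rV[R]_n -> V := fun u => 'D_(delta_mx 0 i) f u.

Fixpoint C_k (k : nat) {n} {V : normedModType R} (U : set 'rV[R]_n)
    (f : 'rV[R]_n -> V) : Prop :=
  if k is k'.+1 then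
    (forall u, U u -> differentiable f u) /\ (forall i, C_k k' U (partial i f))
  else forall u, U u -> {for u, continuous f}.

Definition smooth_on {n} {V : normedModType R} (U : set 'rV[R]_n)
  (f : 'rV[R]_n -> V) := forall k, C_k k U f.

(* Integral with respect to n-dimensional Lebesgue measure of a nonnegative
   Borel function, as an iterated one-dimensional integral (Tonelli). *)
Fixpoint lebesgue_int (n : nat) : ('rV[R]_n -> \bar R) -> \bar R :=
  if n is n'.+1 then fun f =>
    (\int[@lebesgue_measure R]_(x in setT)
       lebesgue_int (fun v : 'rV[R]_n' =>
         f (row_mx (x%:M : 'rV[R]_1) v : 'rV[R]_n'.+1)))%E
  else fun f => f 0.

End Calculus.

Section Manifold.
Context (R : realType) (n : nat).

(* [chart_map] and [chart_inv] are total functions whose values are relevant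
   only on [chart_dom] and on its image. *)
Record chart (M : topologicalType) := Chart {
  chart_dom : set M ;
  chart_map :> M -> 'rV[R]_n ;
  chart_inv : 'rV[R]_n -> M ;
  chart_dom_open : open chart_dom ;
  chart_cod_open : open (chart_map @` chart_dom) ;
  chart_mapK : forall x, chart_dom x -> chart_inv (chart_map x) = x ;
  chart_map_continuous :
    forall x, chart_dom x -> {for x, continuous chart_map} ;
  chart_inv_continuous :
    forall u, (chart_map @` chart_dom) u -> {for u, continuous chart_inv} }.

Definition chart_cod {M} (c : chart M) : set 'rV[R]_n := c @` chart_dom c.

Definition transition {M} (c d : chart M) : 'rV[R]_n -> 'rV[R]_n :=
  d \o chart_inv c.

Definition compatible {M} (c d : chart M) :=
  smooth_on (c @` (chart_dom c `&` chart_dom d)) (transition c d) /\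
  smooth_on (d @` (chart_dom c `&` chart_dom d)) (transition d c).

(* [metric c u] is the Gram matrix of the coordinate vector fields of the
   chart c, at the point of coordinates u. *)
Record riemannian_manifold (M : topologicalType) := RiemannianManifold {
  rm_hausdorff : hausdorff_space M ;
  rm_second_countable : @second_countable M ;
  atlas : set (chart M) ;
  atlas_cover : forall x, exists2 c, atlas c & chart_dom c x ;
  atlas_compatible : forall c d, atlas c -> atlas d -> compatible c d ;
  atlas_maximal :
    forall c, (forall d, atlas d -> compatible c d) -> atlas c ;
  metric : chart M -> 'rV[R]_n -> 'M[R]_n ;
  metric_smooth : forall c, atlas c -> smooth_on (chart_cod c) (metric c) ;
  metric_sym : forall c u, atlas c -> chart_cod c u ->
    (metric c u)^T = metric c u ;
  metric_pos : forall c u, atlas c -> chart_cod c u ->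
    forall v : 'rV[R]_n, v != 0 -> 0 < (v *m metric c u *m v^T) 0 0 ;
  metric_change : forall c d x, atlas c -> atlas d ->
    chart_dom c x -> chart_dom d x ->
    let J := 'J (transition c d) (c x) in
    metric c (c x) = J *m metric d (d x) *m J^T }.

Section Tensors.
Implicit Types (g : 'rV[R]_n -> 'M[R]_n) (u v w : 'rV[R]_n).

Definition inner g u v w : R := (v *m g u *m w^T) 0 0.

Definition christoffel g (k i j : 'I_n) : 'rV[R]_n -> R := fun u =>
  2^-1 * \sum_l invmx (g u) k l *
    (partial i (fun w => g w j l : R^o) u
     + partial j (fun w => g w i l : R^o) u
     - partial l (fun w => g w i j : R^o) u).

(* R(e_i, e_j) e_k = \sum_l (riemann g l k i j) e_l, where
   R(X, Y) Z = D_X (D_Y Z) - D_Y (D_X Z) - D_[X, Y] Z. *)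
Definition riemann g (l k i j : 'I_n) : 'rV[R]_n -> R := fun u =>
  partial i (christoffel g l j k : _ -> R^o) u
  - partial j (christoffel g l i k : _ -> R^o) u
  + \sum_s (christoffel g l i s u * christoffel g s j k u
            - christoffel g l j s u * christoffel g s i k u).

Definition curvature_op g u (v w z : 'rV[R]_n) : 'rV[R]_n :=
  \row_l \sum_i \sum_j \sum_k riemann g l k i j u * v 0 i * w 0 j * z 0 k.

Definition sectional_curvature g u (v w : 'rV[R]_n) : R :=
  inner g u (curvature_op g u v w w) v /
  (inner g u v v * inner g u w w - inner g u v w ^+ 2).

End Tensors.

Section Riemannian.
Context {M : topologicalType} (G : riemannian_manifold M).

Definition nonpositively_curved :=
  forall c u, atlas G c -> chart_cod c u -> forall v w : 'rV[R]_n,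
    row_free (col_mx v w) -> sectional_curvature (metric G c) u v w <= 0.

Definition geodesic_at (gamma : R -> M) (t : R) :=
  {for t, continuous gamma} /\
  forall c, atlas G c -> chart_dom c (gamma t) ->
    let x (k : 'I_n) : R -> R^o := fun s => c (gamma s) 0 k in
    forall k,
      [/\ (\forall s \near t, derivable (x k) s 1),
          derivable (derive1 (x k)) t 1 &
          derive1 (derive1 (x k)) t =
            - \sum_i \sum_j christoffel (metric G c) k i j (c (gamma t))
                            * derive1 (x i) t * derive1 (x j) t].

Definition geodesically_complete :=
  forall c x (v : 'rV[R]_n), atlas G c -> chart_dom c x ->
    exists gamma : R -> M,
      [/\ forall t, geodesic_at gamma t, gamma 0 = x &
          forall k, derive1 ((fun s => c (gamma s) 0 k) : R -> R^o) 0 = v 0 k].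

(* The geodesic equation is required on a neighbourhood of [0, 1]; the values
   of gamma outside [0, 1] are otherwise irrelevant. *)
Definition geodesic_arc (x y : M) (gamma : R -> M) :=
  [/\ gamma 0 = x, gamma 1 = y &
      exists2 e : R, 0 < e & forall t, - e < t < 1 + e -> geodesic_at gamma t].

Definition convex_subset (C : set M) :=
  forall x y gamma, C x -> C y -> geodesic_arc x y gamma ->
    gamma @` `[0, 1] `<=` C.

End Riemannian.

Definition pulled_back {K M : topologicalType} (p : K -> M)
    (GK : riemannian_manifold K) (GM : riemannian_manifold M) :=
  forall (c : chart M) (d : chart K), atlas GM c ->
    (forall x, chart_dom d x -> chart_dom c (p x) /\ d x = c (p x)) ->
    atlas GK d /\ {in chart_cod d, metric GK d =1 metric GM c}.

End Manifold.

Definition borel (M : ptopologicalType) := g_sigma_algebraType (@open M).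

Section Volume.
Context {R : realType} {n : nat} {M : ptopologicalType}.

(* The Riemannian measure: sqrt (det g) du in every chart. *)
Definition riemannian_measure (G : riemannian_manifold R n M)
    (mu : {measure set (borel M) -> \bar R}) :=
  forall (c : chart R n M) (A : set (borel M)), atlas G c -> measurable A ->
    A `<=` chart_dom c ->
    mu A = lebesgue_int
      ((fun u => (Num.sqrt (\det (metric G c u)))%:E) \_ (c @` A)).

(* A convex set need not be Borel, only measurable for the completion of the
   Riemannian measure.  [volume mu] is defined on all sets and agrees with the
   completion of mu on its sigma-algebra, see [volume_completed]. *)
Definition volume (mu : {measure set (borel M) -> \bar R}) (A : set M) :
    \bar R :=
  ereal_sup [set mu B | B in [set B : set (borel M) | measurable B /\ B `<=` A]].

Lemma volume_completed (mu : {measure set (borel M) -> \bar R})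
    (A N : set (borel M)) :
  measurable A -> mu.-negligible N -> volume mu (A `|` N) = mu A.
Proof.
move=> mA [N' [mN' N'0 NN']]; apply/eqP; rewrite eq_le; apply/andP; split.
  apply: ge_ereal_sup => _ [B [mB BAN] <-].
  apply: (@le_trans _ _ (mu (A `|` N'))).
    apply: le_measure; rewrite ?inE//; first exact: measurableU.
    by apply: (subset_trans BAN); exact: setUS.
  by rewrite -[leRHS]adde0 -N'0; exact: measureU2.
by apply: ereal_sup_ubound; exists A => //; split=> //; exact: subsetUl.
Qed.

End Volume.

Section Topology.
Context (R : realType) {T : topologicalType}.

Definition path_between (x y : T) (gamma : R -> T) :=
  [/\ {within `[0, 1], continuous gamma}, gamma 0 = x & gamma 1 = y].

Definition loop_at (x : T) := path_between x x.

Definition path_homotopic (gamma delta : R -> T) :=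
  exists H : R * R -> T,
    [/\ {within `[0, 1] `*` `[0, 1], continuous H},
        forall t, t \in `[0, 1] -> H (t, 0) = gamma t /\ H (t, 1) = delta t &
        forall s, s \in `[0, 1] -> H (0, s) = gamma 0 /\ H (1, s) = gamma 1].

(* The element of pi_1(T, x) represented by gamma. *)
Definition pi1_class (x : T) (gamma : R -> T) : set (R -> T) :=
  [set delta | loop_at x delta /\ path_homotopic gamma delta].

End Topology.

Definition simply_connected (R : realType) (T : topologicalType) :=
  (forall x y : T, exists gamma : R -> T, path_between x y gamma) /\
  (forall (x : T) (gamma : R -> T), loop_at x gamma ->
     path_homotopic gamma (cst x)).

Definition evenly_covered {K M : topologicalType} (p : K -> M) (U : set M) :=
  exists F : set (set K),
    [/\ p @^-1` U = \bigcup_(V in F) V,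
        trivIset F id &
        forall V, F V ->
          [/\ open V, {in V &, injective p}, p @` V = U &
              forall W, open W -> W `<=` V -> open (p @` W)]].

Definition covering_map {K M : topologicalType} (p : K -> M) :=
  [/\ continuous p, range p = setT &
      forall q, exists U, [/\ open U, U q & evenly_covered p U]].

(* Main.v *)
Require Import Defs.
From mathcomp Require Import all_boot all_order all_algebra.
From mathcomp Require Import all_classical all_reals all_analysis.
From mathcomp Require Import measurable_realfun.
Import Order.TTheory GRing.Theory Num.Theory.
Import numFieldNormedType.Exports.

Local Open Scope classical_set_scope.
Local Open Scope ring_scope.

Set Implicit Arguments.
Unset Strict Implicit.
Unset Printing Implicit Defensive.

(** There are two independent ideas: a pigeonhole principle for measures, and
unique lifting of homotopies.

Pigeonhole.  Pulling a chart of M back along one sheet of the covering gives a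
chart of K in which the two metrics have the same expression, so p carries
Riemannian measure to Riemannian measure on a small open set around each point
([covering_measure_preserving]).  By second countability K is covered by
countably many such sets.  Cut a Borel set B contained in C, of volume
exceeding m vol(M), into disjoint pieces D_k along this cover.  Then vol(B) is
the sum of the vol(p(D_k)), that is, the integral over M of the number of k
with q in p(D_k).  If every fiber met B in at most m points, this number would
be at most m, hence vol(B) <= m vol(M), a contradiction ([large_fiber]).  Any m
points of B in one fiber are the required x_1, ..., x_m.

Loops.  The arc from x_i to x_1 stays in C by convexity and projects to a loop
at q.  If the loops of x_i and x_j are homotopic rel endpoints, lift every
stage of the homotopy to the path ending at x_1.  The starting points of these
lifts move continuously and stay in the fiber over q, so they do not move at
all; at the two extreme stages they are x_i and x_j, whence x_i = x_j
([lift_path_homotopic]).  Lifts are handled one parameter at a time: their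
existence, their uniqueness and the continuity of their starting points are
statements about intervals that compose along adjacent intervals and hold on
short ones, so that [interval_induction] proves them all.  To avoid subspace
topologies, paths on a segment are extended to the whole line by precomposition
with the retraction [clamp]. *)

(** * Continuity in one and two variables *)

Lemma near_eq_continuous (S T : topologicalType) (f g : S -> T) (x : S) :
  (\forall y \near x, f y = g y) ->
  {for x, continuous f} -> {for x, continuous g}.
Proof.
move=> fg fc; rewrite /prop_for /continuous_at -(nbhs_singleton fg).
exact: cvg_trans (near_eq_cvg fg) fc.
Qed.

Lemma pair_continuous (S T U : topologicalType) (f : S -> T) (g : S -> U) x :
  {for x, continuous f} -> {for x, continuous g} ->
  {for x, continuous (fun y => (f y, g y))}.
Proof. exact: cvg_pair. Qed.

Lemma slice_continuousl (S T U : topologicalType) (H : S * T -> U) (t : T) :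
  continuous H -> continuous (fun s => H (s, t)).
Proof.
move=> Hc s; apply: (@continuous_comp _ _ _ (fun s => (s, t)) H);
  last exact: Hc.
apply: (@pair_continuous _ _ _ id (cst t)); first exact: cvg_id.
exact: cvg_cst.
Qed.

Lemma slice_continuousr (S T U : topologicalType) (H : S * T -> U) (s : S) :
  continuous H -> continuous (fun t => H (s, t)).
Proof.
move=> Hc t; apply: (@continuous_comp _ _ _ (fun t => (s, t)) H);
  last exact: Hc.
apply: (@pair_continuous _ _ _ (cst s) id); first exact: cvg_cst.
exact: cvg_id.
Qed.

Lemma within_continuous_comp (S T U : topologicalType) (A : set T)
    (f : T -> U) (k : S -> T) :
  continuous k -> (forall s, A (k s)) -> {within A, continuous f} ->
  continuous (f \o k).
Proof.
move=> kc kA /subspace_continuousP fc s B /(fc _ (kA s)) fB.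
have kB : nbhs s (k @^-1` [set t | A t -> B (f t)]) := kc s _ fB.
by apply: (filterS _ kB) => r /=; apply; exact: kA.
Qed.

(** * Induction along an interval *)

Section IntervalInduction.
Context {R : realType}.
Implicit Types (a b t : R).

(** This is the compactness of [a, b] in the form of a supremum argument: the
supremum of the x with P a x satisfies P a x too, and can be passed unless it
is b.  The local hypothesis is one-sided, comparing t with nearby points only,
which spares its users from handling intervals around t. *)
Lemma interval_induction (P : R -> R -> Prop) a b : a <= b ->
  (forall x y z, a <= x -> x <= y -> y <= z -> z <= b ->
     P x y -> P y z -> P x z) ->
  (forall t, a <= t <= b -> \forall s \near t,
     (a <= s <= t -> P s t) /\ (t <= s <= b -> P t s)) ->
  P a b.
Proof.
move=> ab Ptrans Ploc.
pose S := [set x | a <= x <= b /\ P a x].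
have Sa : S a.
  have /Ploc/nbhs_singleton[Paa _] : a <= a <= b by rewrite lexx.
  by split; [rewrite lexx | apply: Paa; rewrite lexx].
have Sb : ubound S b by move=> x [/andP[]].
have supS : has_sup S by split; [exists a | exists b].
set t := sup S.
have at_ : a <= t by apply: ub_le_sup => //; exists b.
have tb : t <= b by apply: ge_sup => //; exists a.
have /Ploc/nbhs_ballP[e /= e0 Pt] : a <= t <= b by rewrite at_.
have [x [/andP[ax xb] Pax] tx] := sup_adherent e0 supS.
have xt : x <= t by apply: ub_le_sup; [exists b | split=> //; rewrite ax].
have Pxt : P x t.
  have [|+ _] := Pt x; last by apply; rewrite ax.
  by rewrite /ball/= ger0_norm ?subr_ge0// ltrBlDl -ltrBlDr.
have Pat : P a t by apply: Ptrans Pax Pxt.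
pose y := Num.min b (t + e / 2).
have ty : t <= y by rewrite le_min tb lerDl divr_ge0// ltW.
have yb : y <= b by rewrite ge_min lexx.
have Pty : P t y.
  have [|_] := Pt y; last by apply; rewrite ty.
  rewrite /ball/= distrC ger0_norm ?subr_ge0// ltrBlDl.
  by rewrite gt_min ltrD2l ltr_pdivrMr// ltr_pMr// ltr1n orbT.
have Pay : P a y by apply: Ptrans Pat Pty.
have yt : y <= t.
  by apply: ub_le_sup; [exists b | split=> //; rewrite (le_trans at_)].
move: yt; rewrite ge_min [X in _ || X]leNgt ltrDl divr_gt0// orbF => bt.
by have <- : t = b by apply/eqP; rewrite eq_le tb.
Qed.

Lemma near_between t (A : set R) : nbhs t A ->
  \forall s \near t, forall r, s <= r <= t \/ t <= r <= s -> A r.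
Proof.
move=> /nbhs_ballP[e /= e0 teA]; apply/nbhs_ballP; exists e => //= s.
rewrite /ball/= => ts r sr; apply: teA; rewrite /ball/=; apply: le_lt_trans ts.
case: sr => /andP[r1 r2].
  by rewrite !ger0_norm ?subr_ge0 ?lerB// (le_trans r1).
by rewrite ![`|t - _|]distrC !ger0_norm ?subr_ge0 ?lerB// (le_trans r1).
Qed.

(** For a <= b, the retraction of the line onto [a, b]. *)
Definition clamp a b (r : R) : R := Num.max a (Num.min b r).

Lemma clamp_continuous a b : continuous (clamp a b).
Proof.
move=> r; apply: (@continuous_max _ _ (cst a) (cst b \min id)).
  exact: cvg_cst.
apply: (@continuous_min _ _ (cst b) id r); first exact: cvg_cst.
exact: cvg_id.
Qed.

Lemma clamp_ge a b r : a <= clamp a b r.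
Proof. by rewrite le_max lexx. Qed.

Lemma clamp_le a b r : a <= b -> clamp a b r <= b.
Proof. by move=> ab; rewrite ge_max ab ge_min lexx. Qed.

Lemma clamp_id a b r : a <= r <= b -> clamp a b r = r.
Proof. by move=> /andP[ar rb]; rewrite /clamp min_r// max_r. Qed.

Lemma continuous_glue (T : topologicalType) (f g : R -> T) t :
  continuous f -> continuous g -> f t = g t ->
  continuous (fun r => if r <= t then f r else g r).
Proof.
move=> fc gc fg r; have [rt|tr|->] := ltgtP r t.
- apply: (near_eq_continuous _ (fc r)).
  near=> s; rewrite ifT//; apply: ltW; near: s; exact: lt_nbhsl.
- apply: (near_eq_continuous _ (gc r)).
  near=> s; rewrite ifF//; apply/negbTE; rewrite -ltNge; near: s.
  exact: lt_nbhsr.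
- move=> A /=; rewrite lexx => tA.
  have gA : nbhs (g t) A by rewrite -fg.
  suff : \forall s \near t, A (if s <= t then f s else g s) by [].
  near=> s; case: ifP => _; near: s; [exact: fc|exact: gc].
Unshelve. all: by end_near.
Qed.

End IntervalInduction.

(** * Sheets of a covering and their inverses *)

Section Sheets.
Context {K M : topologicalType} (p : K -> M).

Definition sheet (U : set M) (V : set K) :=
  [/\ open V, {in V &, injective p}, p @` V = U &
      forall W, open W -> W `<=` V -> open (p @` W)].

Lemma covering_sheet : covering_map p -> forall q, exists U,
  [/\ open U, U q & forall y, U (p y) -> exists2 V, sheet U V & V y].
Proof.
move=> [_ _ pU] q; have [U [oU Uq [F [UF _ FV]]]] := pU q.
exists U; split=> // y Upy.
have : (p @^-1` U) y by [].
by rewrite UF => -[V FVV Vy]; exists V => //; have [? ? ? ?] := FV V FVV.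
Qed.

(** The branch over u of the inverse of p with values in V; the point y is only
a default, and is the value outside p(V). *)
Definition sheet_inv (y : K) (V : set K) (u : M) : K :=
  xget y (V `&` p @^-1` [set u]).

Context (U : set M) (V : set K) (y : K).
Hypothesis VU : sheet U V.
Let s := sheet_inv y V.

Lemma sheet_invP u : U u -> V (s u) /\ p (s u) = u.
Proof.
have [_ _ <- _] := VU; case=> x Vx pxu.
by apply: (@xgetPex _ y (V `&` p @^-1` [set u])); exists x.
Qed.

Lemma sheet_invK x : V x -> s (p x) = x.
Proof.
move=> Vx; have [_ pinj pVU _] := VU.
have [Vs ps] : V (s (p x)) /\ p (s (p x)) = p x.
  by apply: sheet_invP; rewrite -pVU; exists x.
by apply: pinj; rewrite ?inE.
Qed.

Lemma sheet_inv_preimage W : W `<=` V -> U `&` s @^-1` W = p @` W.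
Proof.
have [_ _ pVU _] := VU.
move=> WV; apply/seteqP; split=> [u [Uu /= Wsu]|_ [x Wx <-]].
  by exists (s u) => //; have [] := sheet_invP Uu.
split; first by rewrite -pVU; exists x => //; exact: WV.
by rewrite /= sheet_invK//; exact: WV.
Qed.

Lemma sheet_open : open U.
Proof. by have [oV _ <- pW] := VU; apply: pW. Qed.

Lemma sheet_inv_continuous u : U u -> {for u, continuous s}.
Proof.
move=> Uu A; rewrite nbhsE => -[B [oB Bsu] BA].
have [oV _ _ pW] := VU.
have oW : open (p @` (V `&` B)).
  by apply: pW; [exact: openI | exact: subIsetl].
apply: (@filterS _ (nbhs u) _ (p @` (V `&` B))).
  move=> _ [x [Vx Bx] <-]; apply: BA.
  by rewrite sheet_invK.
apply: open_nbhs_nbhs; split=> //.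
have [Vsu psu] := sheet_invP Uu.
by exists (s u).
Qed.

End Sheets.

(** * Lifting paths and homotopies *)

Section PathLifting.
Context {R : realType} {K M : topologicalType} (p : K -> M).
Hypothesis hK : hausdorff_space K.
Hypothesis pcov : covering_map p.

(** The set where two lifts agree is open because p is injective on sheets, and
its complement is open because K is Hausdorff; the two cases of the proof are
these two facts. *)
Lemma lift_unique (g1 g2 : R -> K) a b : a <= b ->
  continuous g1 -> continuous g2 ->
  (forall t, a <= t <= b -> p (g1 t) = p (g2 t)) ->
  g1 b = g2 b -> g1 a = g2 a.
Proof.
move=> ab cg1 cg2 pg; apply: (@interval_induction _
  (fun x y => g1 y = g2 y -> g1 x = g2 x)) => //.
  by move=> x y z _ _ _ _ xy yz /yz/xy.
move=> t tab; have [g12|/eqP g12] := pselect (g1 t = g2 t).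
  have [U [_ Ut UV]] := covering_sheet pcov (p (g1 t)).
  have [V [oV pinj _ _] Vt] := UV _ Ut.
  have E s : V (g1 s) /\ V (g2 s) -> a <= s <= b -> g1 s = g2 s.
    by move=> [V1 V2] sab; apply: pinj; rewrite ?inE//; exact: pg.
  have : \forall s \near t, V (g1 s) /\ V (g2 s).
    near=> s; split; near: s.
      by apply: (cg1 t); exact: open_nbhs_nbhs.
    by apply: (cg2 t); rewrite -g12; exact: open_nbhs_nbhs.
  apply: filterS => s /E {}E.
  case/andP: tab => at_ tb; split=> // /andP[s1 s2] _; apply: E.
  by rewrite s1 (le_trans s2).
move: hK; rewrite open_hausdorff => /(_ _ _ g12).
move=> [[A B] /= [At Bt] [oA oB /eqP AB0]].
rewrite !inE in At Bt.
have nAB : \forall s \near t, A (g1 s) /\ B (g2 s).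
  near=> s; split; near: s.
    by apply: (cg1 t); exact: open_nbhs_nbhs.
  by apply: (cg2 t); exact: open_nbhs_nbhs.
apply: filterS nAB => s [As Bs]; split=> _.
  by move/eqP; rewrite (negbTE g12).
move=> g12s; have : (A `&` B) (g1 s) by split=> //; rewrite g12s.
by rewrite AB0.
Unshelve. all: by end_near.
Qed.

(** Over a path that stays in an evenly covered set, a lift is the composition
with the inverse of a sheet.  Both the existence of lifts and the continuity of
their starting points reduce to this explicit formula. *)
Lemma lift_in_sheet (f : R -> M) U V x (a b : R) : a <= b -> continuous f ->
  sheet p U V -> (forall r, a <= r <= b -> U (f r)) ->
  V x -> p x = f b ->
  let g := sheet_inv p x V \o f \o clamp a b in
  [/\ continuous g, g b = x & forall r, a <= r <= b -> p (g r) = f r].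
Proof.
move=> ab fc VU fU Vx px g; split.
- move=> r; apply: continuous_comp; first exact: clamp_continuous.
  apply: continuous_comp; first exact: fc.
  by apply: (sheet_inv_continuous VU); apply: fU; rewrite clamp_ge clamp_le.
- by rewrite /g/= clamp_id ?ab ?lexx// -px (sheet_invK x VU).
- move=> r rab; rewrite /g/= clamp_id//.
  by have [] := sheet_invP x VU (fU _ rab).
Qed.

(** Lifts are prescribed at the right end b, since the arcs to be compared
end at a common point. *)
Lemma lift_exists (f : R -> M) a b x : a <= b -> continuous f -> p x = f b ->
  exists g : R -> K,
    [/\ continuous g, g b = x & forall t, a <= t <= b -> p (g t) = f t].
Proof.
move=> ab fc; move: x.
(* Quantifying over the point above f v makes the property compose: the lift on
   [u, v] is taken to end where the lift on [v, w] begins. *)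
apply: (@interval_induction _ (fun u v => forall x, p x = f v ->
  exists g : R -> K,
    [/\ continuous g, g v = x & forall t, u <= t <= v -> p (g t) = f t])) => //.
  move=> u v w _ uv vw _ guv gvw x px.
  have [g2 [cg2 g2w pg2]] := gvw _ px.
  have [|g1 [cg1 g1v pg1]] := guv (g2 v); first by rewrite pg2// lexx.
  exists (fun r => if r <= v then g1 r else g2 r); split.
  - exact: continuous_glue.
  - case: ifP => // wv; have <- : v = w by apply/eqP; rewrite eq_le vw.
    by rewrite g1v -g2w; congr g2; apply/eqP; rewrite eq_le vw.
  - move=> t /andP[ut tw]; case: ifPn => [tv|].
      by apply: pg1; rewrite ut.
    by rewrite -ltNge => /ltW vt; apply: pg2; rewrite vt.
move=> t tab; have [U [oU Ut UV]] := covering_sheet pcov (f t).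
have : \forall s \near t, U (f s) by apply: (fc t); exact: open_nbhs_nbhs.
move=> /near_between; apply: filterS => s fU.
have L u v : u <= v -> (forall r, u <= r <= v -> U (f r)) ->
  forall x, p x = f v -> exists g : R -> K,
    [/\ continuous g, g v = x & forall t, u <= t <= v -> p (g t) = f t].
  move=> uv fUuv x px.
  have [|V VU Vx] := UV x; first by rewrite px; apply: fUuv; rewrite uv lexx.
  by eexists; exact: (lift_in_sheet uv fc VU).
split=> /andP[st ts]; apply: L => // r rst; apply: fU; by [left|right].
Qed.

(** Continuity in the parameter s propagates backwards along the paths h s: over
a short interval, all h s with s near s0 end in one sheet V, hence are there the
image of H under the inverse of V, which is continuous in s. *)
Lemma lift_endpoint_continuous (H : R * R -> M) (h : R -> R -> K) (a b : R) :
  a <= b -> continuous H -> (forall s, continuous (h s)) ->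
  (forall s t, a <= t <= b -> p (h s t) = H (t, s)) ->
  continuous (fun s => h s b) -> continuous (fun s => h s a).
Proof.
move=> ab Hc hc ph hb s0; have := hb s0.
apply: (@interval_induction _ (fun u v =>
  {for s0, continuous (fun s => h s v)} ->
  {for s0, continuous (fun s => h s u)})) => //.
  by move=> x y z _ _ _ _ xy yz /yz/xy.
move=> t tab; have [U [oU Ut UV]] := covering_sheet pcov (H (t, s0)).
have [[A B] [/= At Bs] AB] : nbhs (t, s0) (H @^-1` U).
  by apply: (Hc (t, s0)); exact: open_nbhs_nbhs.
have {}AB u s : A u -> B s -> U (H (u, s)) by move=> *; apply: (AB (u, s)).
have L u v : a <= u -> u <= v -> v <= b -> (forall r, u <= r <= v -> A r) ->
  {for s0, continuous (fun s => h s v)} ->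
  {for s0, continuous (fun s => h s u)}.
  move=> au uv vb Auv cv.
  have uvab r : u <= r <= v -> a <= r <= b.
    by move=> /andP[ur rv]; rewrite (le_trans au)// (le_trans rv).
  have [Au Av] : A u /\ A v by split; apply: Auv; rewrite uv lexx.
  have Bs0 : B s0 by exact: nbhs_singleton.
  have phv s : p (h s v) = H (v, s) by apply: ph; apply: uvab; rewrite uv lexx.
  have [|V VU Vh] := UV (h s0 v); first by rewrite phv; exact: AB.
  pose y := h s0 v.
  (* V does not depend on s, so near s0 the starting point is a composition of
     continuous functions of s. *)
  have near_h : \forall s \near s0, h s u = sheet_inv p y V (H (u, s)).
    have : \forall s \near s0, V (h s v) /\ B s.
      near=> s; split; near: s => //.
      by apply: cv; apply: open_nbhs_nbhs; split=> //; case: VU.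
    apply: filterS => s [Vs Bs'].
    have HsU r : u <= r <= v -> U (H (r, s)).
      by move=> ruv; apply: AB => //; exact: Auv.
    have Hsc : continuous (fun r => H (r, s)).
      exact: slice_continuousl.
    have [gc gv pg] := lift_in_sheet uv Hsc VU HsU Vs (phv s).
    rewrite (lift_unique uv (hc s) gc _ _) ?gv//=; last first.
      by move=> r ruv; rewrite pg// ph// uvab.
    rewrite clamp_id ?lexx//.
    have [] := sheet_invP (h s v) VU (HsU u _); first by rewrite lexx.
    by move=> V1 p1; rewrite -[in RHS]p1 (sheet_invK _ VU V1).
  have near_h' : \forall s \near s0, sheet_inv p y V (H (u, s)) = h s u.
    by apply: filterS near_h => s ->.
  apply: (near_eq_continuous near_h').
  apply: (@continuous_comp _ _ _ (fun s => H (u, s)) (sheet_inv p y V)).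
    exact: slice_continuousr.
  exact: (sheet_inv_continuous VU (AB _ _ Au Bs0)).
move: At => /near_between; apply: filterS => s fA.
by case/andP: tab => at_ tb; split=> /andP[s1 s2];
  apply: L => // r rst; apply: fA; [left|right].
Unshelve. all: by end_near.
Qed.

(** The starting points h s 0 of the lifts of the stages of the homotopy form a
continuous path that lies over the single point q.  So does a constant path,
and uniqueness of lifts forces the former to be constant. *)
Lemma monodromy (H : R * R -> M) (g0 g1 : R -> K) (x : K) (q : M) :
  continuous H -> (forall s, H (0, s) = q) -> (forall s, H (1, s) = p x) ->
  continuous g0 -> continuous g1 ->
  (forall t, 0 <= t <= 1 -> p (g0 t) = H (t, 0)) ->
  (forall t, 0 <= t <= 1 -> p (g1 t) = H (t, 1)) ->
  g0 1 = x -> g1 1 = x -> g0 0 = g1 0.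
Proof.
move=> Hc H0 H1 g0c g1c pg0 pg1 g0x g1x.
have Hsc s : continuous (fun r => H (r, s)).
  exact: slice_continuousl.
have /choice[h hP] : forall s, exists g : R -> K,
    [/\ continuous g, g 1 = x & forall t, 0 <= t <= 1 -> p (g t) = H (t, s)].
  by move=> s; apply: lift_exists.
have hc s : continuous (h s) by have [] := hP s.
have hx s : h s 1 = x by have [] := hP s.
have ph s t : 0 <= t <= 1 -> p (h s t) = H (t, s).
  by have [_ _] := hP s; apply.
have ec : continuous (fun s => h s 0).
  apply: (lift_endpoint_continuous ler01 Hc hc ph).
  rewrite (_ : (fun s => h s 1) = cst x); last exact/funext.
  by move=> s; exact: cvg_cst.
have -> : g0 0 = h 0 0.
  apply: (lift_unique ler01 g0c (hc 0)); last by rewrite hx.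
  by move=> t t01; rewrite pg0// ph.
have -> : g1 0 = h 1 0.
  apply: (lift_unique ler01 g1c (hc 1)); last by rewrite hx.
  by move=> t t01; rewrite pg1// ph.
apply: (lift_unique ler01 ec (g2 := cst (h 1 0))) => //.
  by move=> s; exact: cvg_cst.
by move=> t t01; rewrite /= !ph ?lexx ?ler01// !H0.
Qed.

Lemma lift_path_homotopic (g0 g1 : R -> K) :
  {within `[0, 1], continuous g0} -> {within `[0, 1], continuous g1} ->
  g0 1 = g1 1 -> path_homotopic (p \o g0) (p \o g1) -> g0 0 = g1 0.
Proof.
move=> g0c g1c g01 [H [Hc Ht Hs]].
pose c := @clamp R 0 1.
have c01 r : c r \in `[0, 1] by rewrite in_itv/= clamp_ge clamp_le.
have cE r : 0 <= r <= 1 -> c r = r by exact: clamp_id.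
have gc (g : R -> K) : {within `[0, 1], continuous g} -> continuous (g \o c).
  by apply: within_continuous_comp; [exact: clamp_continuous | exact: c01].
have Hc' : continuous (fun z => H (c z.1, c z.2)).
  apply: (@within_continuous_comp _ _ _ _ H (fun z => (c z.1, c z.2)) _ _ Hc).
    move=> z; apply: (@pair_continuous _ _ _ (c \o fst) (c \o snd)).
      apply: (@continuous_comp _ _ _ fst c); first exact: cvg_fst.
      exact: clamp_continuous.
    apply: (@continuous_comp _ _ _ snd c); first exact: cvg_snd.
    exact: clamp_continuous.
  by move=> z; split; exact: c01.
have i0 : (0 : R) \in `[0, 1] by rewrite in_itv/= lexx ler01.
have i1 : (1 : R) \in `[0, 1] by rewrite in_itv/= lexx ler01.
have c0 : c 0 = 0 by apply: cE; rewrite lexx ler01.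
have c1 : c 1 = 1 by apply: cE; rewrite lexx ler01.
have := @monodromy _ (g0 \o c) (g1 \o c) (g0 1) (p (g0 0)) Hc'.
rewrite /= c0 c1; apply => //; try exact: gc.
- by move=> s; have [] := Hs _ (c01 s).
- by move=> s; have [] := Hs _ (c01 s).
- by move=> t t01; have [] := Ht _ (c01 t).
- by move=> t t01; have [] := Ht _ (c01 t).
Qed.

End PathLifting.

(** * Pulling a chart back along a sheet *)

Section LiftedChart.
Context (R : realType) (n : nat) (K M : topologicalType) (p : K -> M).
Context (c : chart R n M) (U : set M) (V : set K) (y : K).
Hypotheses (pc : continuous p) (VU : sheet p U V).

Lemma chart_image_open (O : set M) : open O -> O `<=` chart_dom c ->
  open (c @` O).
Proof.
move=> oO Oc; rewrite openE => _ [x Ox <-]; rewrite /interior.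
have cx : (c @` chart_dom c) (c x) by exists x => //; exact: Oc.
have invO : nbhs (c x) (chart_inv c @^-1` O).
  apply: (chart_inv_continuous cx); rewrite chart_mapK; last exact: Oc.
  exact: open_nbhs_nbhs.
have codc : nbhs (c x) (c @` chart_dom c).
  by apply: open_nbhs_nbhs; split=> //; exact: chart_cod_open.
apply: filterS2 invO codc => w /= + [z cz zw]; rewrite -{w}zw.
by rewrite chart_mapK// => Oz; exists z.
Qed.

Let D := V `&` p @^-1` chart_dom c.

Lemma lifted_dom_open : open D.
Proof.
case: VU => oV _ _ _; apply: openI => //.
by apply: open_comp; [move=> x _; exact: pc | exact: chart_dom_open].
Qed.

(** Openness of the range of the pulled-back chart thus reduces to openness of
the image under c of an open subset of M. *)
Lemma lifted_cod : (c \o p) @` D = c @` (U `&` chart_dom c).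
Proof.
case: VU => _ _ <- _; apply/seteqP; split=> [_ [x [Vx cx] <-]|].
  by exists (p x) => //; split=> //; exists x.
by move=> _ [_ [[x Vx <-] cx] <-]; exists x.
Qed.

Lemma lifted_cod_open : open ((c \o p) @` D).
Proof.
rewrite lifted_cod; apply: chart_image_open; last exact: subIsetr.
by apply: openI; [exact: sheet_open VU | exact: chart_dom_open].
Qed.

Lemma lifted_mapK x : D x -> (sheet_inv p y V \o chart_inv c) ((c \o p) x) = x.
Proof. by move=> [Vx cx]; rewrite /= chart_mapK// (sheet_invK y VU). Qed.

Lemma lifted_map_continuous x : D x -> {for x, continuous (c \o p)}.
Proof.
move=> [_ cx]; apply: continuous_comp; first exact: pc.
exact: chart_map_continuous.
Qed.

Lemma lifted_inv_continuous u : ((c \o p) @` D) u ->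
  {for u, continuous (sheet_inv p y V \o chart_inv c)}.
Proof.
rewrite lifted_cod => -[z [Uz cz] <-].
apply: continuous_comp; first by apply: chart_inv_continuous; exists z.
by rewrite chart_mapK//; exact: (sheet_inv_continuous VU Uz).
Qed.

Definition lifted_chart : chart R n K :=
  Chart lifted_dom_open lifted_cod_open lifted_mapK lifted_map_continuous
    lifted_inv_continuous.

End LiftedChart.

(** * The pigeonhole principle for measures *)

Lemma second_countable_cover (T : ptopologicalType) (P : set T -> Prop) :
  @second_countable T -> (forall V W, V `<=` W -> P W -> P V) ->
  (forall x, exists W, [/\ open W, W x & P W]) ->
  exists F : nat -> set T,
    (forall k, open (F k) /\ P (F k)) /\ \bigcup_k F k = setT.
Proof.
move=> [B cB [oB bB]] Psub Ploc.
have Pbasis x : exists2 b, (B b /\ P b) & b x.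
  have [W [oW Wx PW]] := Ploc x.
  have /bB[b [Bb bx] bW] : nbhs x W by exact: open_nbhs_nbhs.
  by exists b => //; split=> //; exact: Psub PW.
have cG : countable [set b | B b /\ P b].
  by apply: sub_countable cB; apply: subset_card_le => b [].
have /pfcard_geP[G0|[f]] := cG.
  have [b bG _] := Pbasis point.
  by have : [set b | B b /\ P b] b := bG; rewrite G0.
exists f; split=> [k|].
  have [Bfk Pfk] := @funS _ _ _ _ f k I.
  by split=> //; exact: oB.
apply/seteqP; split=> // x _; have [b bG bx] := Pbasis x.
by have [k _ fk] := @surj _ _ _ _ f b bG; exists k => //; rewrite fk.
Qed.

(** Both sides are integrals: of the number of A k containing x, and of the
constant m. *)
Lemma sum_measure_le (d : measure_display) (T : measurableType d)
    (R : realType) (mu : {measure set T -> \bar R}) (A : nat -> set T)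
    (N m : nat) :
  (forall k, measurable (A k)) ->
  (forall x, (\sum_(0 <= k < N) `[< A k x >] <= m)%N) ->
  (\sum_(0 <= k < N) mu (A k) <= m%:R%:E * mu setT)%E.
Proof.
move=> mA Am.
have mind k : measurable_fun [set: T] (EFin \o (\1_(A k) : T -> R)).
  by apply/measurable_EFinP; exact: measurable_indic.
have -> : (\sum_(0 <= k < N) mu (A k) =
    \int[mu]_x \sum_(0 <= k < N) (\1_(A k) x : R)%:E)%E.
  rewrite ge0_integral_sum//.
  by apply: eq_bigr => k _; rewrite integral_indic// setIT.
rewrite -integral_cst//; apply: ge0_le_integral => //.
- by move=> x _; apply: sume_ge0.
- exact: emeasurable_sum.
- move=> x _ /=.
  rewrite sumEFin lee_fin (_ : \sum_(_ <= _ < _) _ =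
    (\sum_(0 <= k < N) `[< A k x >])%N%:R) ?ler_nat//.
  rewrite natr_sum; apply: eq_bigr => k _; rewrite indicE; congr (_%:R).
Qed.

Section RiemannianCovering.
Context (R : realType) (n : nat) (K M : ptopologicalType) (p : K -> M).

(** On V the image under p is the preimage under the inverse of the sheet, and
preimages commute with the operations generating the Borel sets. *)
Lemma sheet_image_measurable (U : set M) (V : set K) (A : set (borel K)) :
  sheet p U V -> measurable A -> A `<=` V -> measurable (p @` A : set (borel M)).
Proof.
move=> VU mA AV; rewrite -(sheet_inv_preimage (point : K) VU AV).
have mU : measurable (U : set (borel M)).
  by apply: sub_sigma_algebra; exact: sheet_open VU.
set s := sheet_inv p _ V.
suff : measurable `<=` [set B : set (borel K) |
    measurable (U `&` s @^-1` B : set (borel M))] by exact.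
apply: smallest_sub; first split.
- by rewrite /= preimage_set0 setI0.
- move=> B /= mB; rewrite setTD preimage_setC.
  rewrite (_ : _ `&` _ = U `\` (U `&` s @^-1` B)); first exact: measurableD.
  by apply/seteqP; split=> u [Uu nBu]; (split=> // Bu; apply: nBu);
    [case: Bu | split].
- by move=> B /= mB; rewrite preimage_bigcup setI_bigcupr; exact: bigcup_measurable.
- move=> O oO; apply: sub_sigma_algebra.
  rewrite /= openE => u [Uu Osu]; rewrite /interior.
  apply: filterI.
    by apply: open_nbhs_nbhs; split=> //; exact: sheet_open VU.
  by apply: (sheet_inv_continuous VU Uu); exact: open_nbhs_nbhs.
Qed.

Context (GM : riemannian_manifold R n M) (GK : riemannian_manifold R n K).
Context (volM : {measure set (borel M) -> \bar R}).
Context (volK : {measure set (borel K) -> \bar R}).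
Hypotheses (pcov : covering_map p) (pGK : pulled_back p GK GM).
Hypotheses (GvolM : riemannian_measure GM volM).
Hypotheses (GvolK : riemannian_measure GK volK).

(** Images rather than preimages are measured so that the property passes to
smaller sets, as it must when the pieces of a cover are made disjoint. *)
Definition measure_preserving_on (W : set K) :=
  forall A : set (borel K), measurable A -> A `<=` W ->
    measurable (p @` A : set (borel M)) /\ volM (p @` A) = volK A.

(** In the chart d pulled back from c along a sheet, A has the same coordinates
as p(A) in c, and the two metrics have the same Gram matrix there: both volumes
are the same Lebesgue integral. *)
Lemma covering_measure_preserving x :
  exists W, [/\ open W, W x & measure_preserving_on W].
Proof.
have pc : continuous p by case: pcov.
have [c ac cx] := atlas_cover GM (p x).
have [U [_ Ux UV]] := covering_sheet pcov (p x).
have [V VU Vx] := UV x Ux.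
pose d := lifted_chart c x pc VU.
have [ad gd] : atlas GK d /\ {in chart_cod d, metric GK d =1 metric GM c}.
  by apply: pGK => // z [].
exists (chart_dom d); split; [exact: chart_dom_open | by [] |].
move=> A mA Ad.
have mpA : measurable (p @` A : set (borel M)).
  by apply: (sheet_image_measurable VU mA) => z /Ad[].
split=> //; rewrite (GvolM ac mpA); last by move=> _ [z /Ad[_ +] <-].
rewrite (GvolK ad mA Ad) image_comp; congr lebesgue_int; apply/funext => u.
rewrite /patch; case: ifPn => // /set_mem uA; congr ((Num.sqrt (\det _))%:E).
rewrite gd// inE; case: uA => z Az <-; exists z => //; exact: Ad.
Qed.

(** If every fiber met B in at most m points, then at most m of the images of
the disjoint pieces D k of B could contain a given q: points of distinct pieces
over q are distinct.  Summing the volumes of the images contradicts the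
hypothesis. *)
Lemma large_fiber (m : nat) (B : set (borel K)) :
  measurable B -> (m%:R%:E * volM setT < volK B)%E ->
  exists q (s : seq K),
    [/\ uniq s, (m < size s)%N & forall x, x \in s -> B x /\ p x = q].
Proof.
move=> mB; apply: contraPP => /forallNP few; apply/negP; rewrite -leNgt.
have sub_preserving V W : V `<=` W ->
    measure_preserving_on W -> measure_preserving_on V.
  by move=> VW pW A mA AV; apply: pW => //; exact: subset_trans VW.
have [F [FP Fcover]] := second_countable_cover (rm_second_countable GK)
  sub_preserving covering_measure_preserving.
have mF k : measurable (F k : set (borel K)).
  by apply: sub_sigma_algebra; exact: (FP k).1.
pose D k : set (borel K) := B `&` seqDU F k.
have mD k : measurable (D k).
  apply: measurableI => //; rewrite /seqDU; apply: measurableD => //.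
  by rewrite -bigcup_mkord; exact: bigcup_measurable.
have DF k : D k `<=` F k by move=> x [_]; exact: subset_seqDU.
have triD : trivIset setT D.
  by apply: trivIset_setIl; exact: trivIset_seqDU.
have pD k : measurable (p @` D k : set (borel M)) /\ volM (p @` D k) = volK (D k).
  by apply: (FP k).2.
have -> : B = \bigcup_k D k.
  by rewrite -setI_bigcupr -seqDU_bigcup_eq Fcover setIT.
rewrite measure_bigcup//; apply: lime_le.
  by apply: is_cvg_nneseries.
apply: nearW => N.
under eq_bigl do rewrite in_setT.
under eq_bigr do rewrite -(pD _).2.
apply: sum_measure_le => [k|q]; first exact: (pD k).1.
rewrite leqNgt; apply/negP => mN.
pose y k := xget point (D k `&` p @^-1` [set q]).
have yP k : (p @` D k) q -> D k (y k) /\ p (y k) = q.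
  move=> [x Dx px].
  by apply: (@xgetPex _ point (D k `&` p @^-1` [set q])); exists x.
pose I := [seq k <- iota 0 N | `[< (p @` D k) q >]].
have IP k : k \in I -> D k (y k) /\ p (y k) = q.
  by rewrite mem_filter => /andP[/asboolP/yP].
apply: (few q); exists (map y I); split.
- rewrite map_inj_in_uniq ?filter_uniq ?iota_uniq// => i j /IP[Di _] /IP[Dj _] yij.
  by apply: triD => //; exists (y i); split=> //; rewrite yij.
- rewrite size_map size_filter -sum1_count big_mkcond/=.
  apply: leq_trans mN _; rewrite /index_iota subn0.
  by apply: leq_sum => k _; case: asboolP.
- by move=> x /mapP[k /IP[[Bk _] pk] ->].
Qed.

End RiemannianCovering.

(** * Arcs, loops and the theorem *)

Lemma geodesic_arc_continuous (R : realType) (n : nat) (K : topologicalType)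
    (G : riemannian_manifold R n K) (x y : K) (gamma : R -> K) :
  geodesic_arc G x y gamma -> {within `[0, 1], continuous gamma}.
Proof.
move=> [_ _ [e e0 geo]]; apply: continuous_in_subspaceT => t.
rewrite inE/= in_itv/= => /andP[t0 t1].
have /geo[gt _] : - e < t < 1 + e.
  by rewrite (lt_le_trans _ t0) ?oppr_lt0//= (le_lt_trans t1)// ltrDl.
exact: gt.
Qed.

Lemma path_homotopic_refl (R : realType) (T : topologicalType) (g : R -> T) :
  {within `[0, 1], continuous g} -> path_homotopic g g.
Proof.
move=> /subspace_continuousP gc; exists (g \o fst); split=> //.
apply/subspace_continuousP => z [z1 z2] B /(gc _ z1) gB.
have : nbhs z (fst @^-1` [set t : R | t \in `[0, 1] -> B (g t)]).
  exact: (@cvg_fst _ _ (nbhs z.1) (nbhs z.2) _ _ gB).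
by apply: filterS => w /= + [w1 _]; exact.
Qed.

Theorem theorem1p1 (R : realType) (n : nat) (M K : ptopologicalType)
    (GM : riemannian_manifold R n M) (GK : riemannian_manifold R n K)
    (volM : {measure set (borel M) -> \bar R})
    (volK : {measure set (borel K) -> \bar R})
    (p : K -> M) (m : nat) (C : set K) :
  connected [set: M] ->
  geodesically_complete GM ->
  nonpositively_curved GM ->
  riemannian_measure GM volM ->
  (volM setT < +oo)%E ->
  simply_connected R K ->
  covering_map p ->
  pulled_back p GK GM ->
  riemannian_measure GK volK ->
  (1 <= m)%N ->
  convex_subset GK C ->
  (m%:R%:E * volM setT < volume volK C)%E ->
  exists (x : nat -> K) (q : M),
    [/\ forall i, (1 <= i <= m)%N -> C (x i) /\ p (x i) = q,
        forall i j, (1 <= i <= m)%N -> (1 <= j <= m)%N -> i <> j ->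
          x i <> x j &
        forall gamma : nat -> R -> K,
          (forall i, (2 <= i <= m)%N ->
             geodesic_arc GK (x i) (x 1%N) (gamma i)) ->
          (forall i, (2 <= i <= m)%N ->
             gamma i @` `[0, 1] `<=` C /\ loop_at q (p \o gamma i)) /\
          (forall i j, (2 <= i <= m)%N -> (2 <= j <= m)%N -> i <> j ->
             pi1_class q (p \o gamma i) <> pi1_class q (p \o gamma j))].
Proof.
move=> _ _ _ GvolM _ _ pcov pGK GvolK m1 Cconvex.
have pc : continuous p by case: pcov.
(* [volume] is an inner measure, so that C contains a Borel set B whose measure
   already exceeds m vol(M). *)
move=> /ereal_sup_gt[_ [B [mB BC] <-] mBvol].
have [q [s [us ms sB]]] := large_fiber pcov pGK GvolM GvolK mB mBvol.
(* The points are numbered from 1, the entries of s from 0. *)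
pose x i := nth point s i.-1.
have index_lt i : (1 <= i <= m)%N -> (i.-1 < size s)%N.
  by case: i => // i /= im; rewrite (leq_trans im)// ltnW.
have xs i : (1 <= i <= m)%N -> x i \in s by move=> im; rewrite mem_nth ?index_lt.
have Cx i : (1 <= i <= m)%N -> C (x i) /\ p (x i) = q.
  by move=> /xs/sB[/BC].
have x_inj i j : (1 <= i <= m)%N -> (1 <= j <= m)%N -> i <> j -> x i <> x j.
  move=> im jm ij /eqP; rewrite nth_uniq ?index_lt// => /eqP.
  by case: i j im jm ij => [|i] [|j]//= _ _ ij ij'; apply: ij; rewrite ij'.
exists x, q; split=> // gamma geo.
have [Cx1 px1] : C (x 1%N) /\ p (x 1%N) = q by apply: Cx; rewrite leqnn.
have im1 i : (2 <= i <= m)%N -> (1 <= i <= m)%N.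
  by move=> /andP[i2 im]; rewrite im ltnW.
have gc i : (2 <= i <= m)%N -> {within `[0, 1], continuous (gamma i)}.
  by move=> /geo/geodesic_arc_continuous.
have loop i : (2 <= i <= m)%N -> loop_at q (p \o gamma i).
  move=> im; have [g0 g1 _] := geo i im; split.
  - move=> t.
    apply: (@continuous_comp (subspace [set` `[(0 : R), 1]]) K M (gamma i) p).
      exact: gc.
    exact: pc.
  - by rewrite /= g0; have [] := Cx i (im1 _ im).
  - by rewrite /= g1.
split=> [i im|i j im jm ij pi1E].
  split; last exact: loop.
  by apply: (Cconvex _ _ _ _ Cx1 (geo i im)); have [] := Cx i (im1 _ im).
have [gi0 gi1 _] := geo i im; have [gj0 gj1 _] := geo j jm.
(* Classes are sets of loops; the loop of x_j lies in its own class, hence in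
   that of x_i. *)
have : pi1_class q (p \o gamma j) (p \o gamma j).
  by split; [exact: loop | apply: path_homotopic_refl; have [] := loop j jm].
rewrite -pi1E => -[_ hom].
apply: (x_inj i j (im1 _ im) (im1 _ jm) ij); rewrite -gi0 -gj0.
apply: (lift_path_homotopic (rm_hausdorff GK) pcov (gc i im) (gc j jm)) => //.
by rewrite gi1 gj1.
Qed.
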